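(* Let $\varepsilon>0$. Consider the IMEX1-DG1-S scheme (the first-order-in-time scheme with piecewise constant discrete space $U_h^0$) with periodic boundary conditions in $x$, on a mesh with maximal size $h$ and mesh regularity parameter $\delta$, with $\sigma_a\ge 0$ and $\sigma_s(x)\ge\sigma_m>0$ for all $x\in\Omega_x$. Then: (i) If $$\frac{\varepsilon}{\sigma_m h}\le \frac{\delta}{2\|v\|_\infty},$$ the scheme is unconditionally stable, i.e. it is stable for every $\Delta t>0$. (ii) Otherwise, the scheme is stable under the time step condition $$0<\Delta t\le \frac{2\varepsilon^2 h}{2\varepsilon\|v\|_\infty/\delta-\sigma_m h}.$$
   Context: **Mesh and space.** $\Omega_x=[x_L,x_R]$ is partitioned into cells $I_i=[x_{i-1/2},x_{i+1/2}]$, $i=1,\dots,N$, with $h_i=x_{i+1/2}-x_{i-1/2}$, $h=\max_i h_i$, and $h_i/h\ge\delta$ for all $i$ with some $\delta>0$. $U_h^k=\{u\in L^2(\Omega_x): u|_{I_i}\in P^k(I_i)\ \forall i\}$ where $P^k(I_i)$ denotes polynomials of degree at most $k$; IMEX1-DG1-S uses $k=0$. $u^\pm_{i-1/2}$ are the right/left limits of $u$ at $x_{i-1/2}$, and $[u]_{i-1/2}=u^+_{i-1/2}-u^-_{i-1/2}$. Boundary conditions are periodic: $x_{1/2}$ and $x_{N+1/2}$ are identified, and sums over interfaces $x_{i-1/2}$ run over $i=1,\dots,N$. $(\cdot,\cdot)$ and $\|\cdot\|$ are the $L^2(\Omega_x)$ inner product and norm. **Velocity discretization.** $\Omega_v\subset\mathbb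 R$ is bounded, $\|v\|_\infty=\sup_{v\in\Omega_v}|v|>0$. $v_1,\dots,v_{N_v}\in\Omega_v$ are quadrature points with nonnegative weights $\omega_1,\dots,\omega_{N_v}$, and $\langle\eta\rangle_h=\sum_{l=1}^{N_v}\omega_l\,\eta(v_l)$. A function $g_h$ is a family $(g_{h,l})_{l=1}^{N_v}$, $g_{h,l}=g_h(\cdot,v_l)\in U_h^k$. **Bilinear forms** (for $\rho,\phi,\psi,w\in U_h^k$): $$d_h(\rho,\psi)=\sum_i\int_{I_i}\rho\,\partial_x\psi\,dx+\sum_i\rho^-_{i-1/2}[\psi]_{i-1/2},\qquad l_h(w,\phi)=-\sum_i\int_{I_i}w\,\partial_x\phi\,dx-\sum_i w^+_{i-1/2}[\phi]_{i-1/2}.$$ For $g\in U_h^k$ and $v\in\mathbb R$, $\mathcal D_h^{up}(g;v)\in U_h^k$ is defined by $$(\mathcal D_h^{up}(g;v),\psi)=-\sum_i\int_{I_i}v g\,\partial_x\psi\,dx-\sum_i\widetilde{(vg)}_{i-1/2}[\psi]_{i-1/2}\quad\forall\psi\in U_h^k,$$ where $\widetilde{(vg)}_{i-1/2}=v g^-_{i-1/2}$ if $v\ge0$ and $v g^+_{i-1/2}$ if $v<0$. Set $$b_{h,v}(g_{h,l},\psi)=(\mathcal D_h^{up}(g_{h,l};v_l),\psi)-\Big(\sum_{l'=1}^{N_v}\omega_{l'}\mathcal D_h^{up}(g_{h,l'};v_{l'}),\psi\Big).$$ **Scheme.** Coefficients $\sigma_s,\sigma_a:\Omega_x\to\mathbb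 R$ are bounded and measurable. Given $\rho_h^n\in U_h^k$ and $g_{h,l}^n\in U_h^k$, with a fixed time step $\Delta t>0$, find $\rho_h^{n+1},g_{h,l}^{n+1}\in U_h^k$ such that for all $\phi,\psi\in U_h^k$ and $l=1,\dots,N_v$, $$\Big(\tfrac{\rho_h^{n+1}-\rho_h^n}{\Delta t},\phi\Big)+l_h(\langle v g_h^{n+1}\rangle_h,\phi)=-(\sigma_a\rho_h^{n+1},\phi),$$ $$\Big(\tfrac{g_{h,l}^{n+1}-g_{h,l}^n}{\Delta t},\psi\Big)+\tfrac1\varepsilon b_{h,v}(g_{h,l}^n,\psi)-\tfrac{1}{\varepsilon^2}v_l\,d_h(\rho_h^{n+1},\psi)=-\tfrac1{\varepsilon^2}(\sigma_s g_{h,l}^{n+1},\psi)-(\sigma_a g_{h,l}^{n+1},\psi).$$ The numerical solution is taken to satisfy $\langle g_h^n\rangle_h=0$ for all $n\ge0$ (a property of the scheme when $\sum_l\omega_l=1$, $\sum_l\omega_l v_l=0$ and $\langle g_h^0\rangle_h=0$). **Energy and stability.** $|||g|||^2=\langle(g,g)\rangle_h$, $|||g|||_s^2=\langle(\sigma_s g,g)\rangle_h$, and for $\mu\in[0,1]$ $$E_{\mu,h}^n=\|\rho_h^n\|^2+\varepsilon^2|||g_h^n|||^2+(1-\mu)\Delta t\,|||g_h^n|||_s^2.$$ The scheme (with a given $\Delta t$) is $\mu$-stable if $E_{\mu,h}^{n+1}\le E_{\mu,h}^n$ for all $n\ge0$. It is stable if there exists $\mu\in[0,1]$ such that it is $\mu$-stable.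 It is unconditionally stable if it is stable for arbitrary $\Delta t>0$. *)

(* Defs.v *)
From HB Require Import structures.
From mathcomp Require Import all_boot all_order all_algebra.
From mathcomp Require Import all_classical all_reals all_analysis.

Set Implicit Arguments.
Unset Strict Implicit.
Unset Printing Implicit Defensive.

Import Order.TTheory GRing.Theory Num.Theory.
Import numFieldNormedType.Exports.

Local Open Scope classical_set_scope.
Local Open Scope ring_scope.

(* Indices are shifted by one: the node [xs i], 0 <= i <= N, is x_{i+1/2}, and
   the cell [i : 'I_N] is [[xs i, xs i.+1]].  Only [xs 0], ..., [xs N] are used. *)

Section Mesh.
Context {R : realType}.
Variables (N : nat) (xs : nat -> R).

Notation mu := (@lebesgue_measure R).

Definition Omega_x : set R := `[xs 0, xs N]%classic.

Definition cell (i : 'I_N) : set R := `[xs i, xs i.+1]%classic.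

Definition cell_size (i : 'I_N) : R := xs i.+1 - xs i.

Definition mesh_size : R := \big[Num.max/0]_(i < N) cell_size i.

(* U_h^k.  An element of L^2(Omega_x) with polynomial restrictions to the cells
   is represented by a function that equals the polynomials on the open cells;
   its values at the nodes and outside Omega_x are irrelevant. *)
Definition Uh (k : nat) (u : R -> R) : Prop :=
  forall i : 'I_N, exists2 p : {poly R}, (size p <= k.+1)%N &
    forall x, xs i < x < xs i.+1 -> u x = p.[x].

Definition inner (u w : R -> R) : R := \int[mu]_(x in Omega_x) (u x * w x).

Definition L2norm (u : R -> R) : R := Num.sqrt (inner u u).

(* [i : 'I_N] also numbers the interfaces x_{1/2}, ..., x_{N-1/2}.  By
   periodicity the left limit at x_{1/2} is the one at x_{N+1/2}. *)
Definition trace_plus (u : R -> R) (i : 'I_N) : R :=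
  lim (u x @[x --> (xs i)^'+]).

Definition trace_minus (u : R -> R) (i : 'I_N) : R :=
  lim (u x @[x --> (xs (if i == 0%N :> nat then N else i))^'-]).

Definition jump (u : R -> R) (i : 'I_N) : R := trace_plus u i - trace_minus u i.

Definition d_h (rho psi : R -> R) : R :=
  \sum_(i < N) \int[mu]_(x in cell i) (rho x * derive1 psi x) +
  \sum_(i < N) trace_minus rho i * jump psi i.

Definition l_h (w phi : R -> R) : R :=
  - (\sum_(i < N) \int[mu]_(x in cell i) (w x * derive1 phi x)) -
  \sum_(i < N) trace_plus w i * jump phi i.

Definition upwind_flux (g : R -> R) (v : R) (i : 'I_N) : R :=
  if 0 <= v then v * trace_minus g i else v * trace_plus g i.

Definition is_D_up (k : nat) (g : R -> R) (v : R) (D : R -> R) : Prop :=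
  Uh k D /\
  forall psi : R -> R, Uh k psi ->
    inner D psi =
      - (\sum_(i < N) \int[mu]_(x in cell i) (v * g x * derive1 psi x)) -
      \sum_(i < N) upwind_flux g v i * jump psi i.

(* [is_D_up k g v] determines D only up to its values off the open cells; [get]
   selects a representative. *)
Definition D_up (k : nat) (g : R -> R) (v : R) : R -> R :=
  get [set D | is_D_up k g v D].

End Mesh.

Section Scheme.
Context {R : realType}.
Variables (k N : nat) (xs : nat -> R).
Variables (Nv : nat) (omega v : 'I_Nv -> R).
Variables (eps : R) (sigma_s sigma_a : R -> R).

Notation mu := (@lebesgue_measure R).

Definition avg (eta : 'I_Nv -> R) : R := \sum_(l < Nv) omega l * eta l.

Definition b_hv (g : 'I_Nv -> R -> R) (l : 'I_Nv) (psi : R -> R) : R :=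
  inner N xs (D_up N xs k (g l) (v l)) psi -
  inner N xs (fun x => avg (fun l' => D_up N xs k (g l') (v l') x)) psi.

Definition scheme_rho (dt : R) (rho rho' : R -> R) (g' : 'I_Nv -> R -> R) :=
  forall phi : R -> R, Uh N xs k phi ->
    inner N xs (fun x => (rho' x - rho x) / dt) phi +
    l_h N xs (fun x => avg (fun l => v l * g' l x)) phi =
    - inner N xs (fun x => sigma_a x * rho' x) phi.

Definition scheme_g (dt : R) (g g' : 'I_Nv -> R -> R) (rho' : R -> R) :=
  forall (psi : R -> R) (l : 'I_Nv), Uh N xs k psi ->
    inner N xs (fun x => (g' l x - g l x) / dt) psi +
    eps^-1 * b_hv g l psi -
    (eps ^+ 2)^-1 * (v l * d_h N xs rho' psi) =
    - ((eps ^+ 2)^-1 * inner N xs (fun x => sigma_s x * g' l x) psi) -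
    inner N xs (fun x => sigma_a x * g' l x) psi.

Definition numerical_solution (dt : R)
    (rho : nat -> R -> R) (g : nat -> 'I_Nv -> R -> R) : Prop :=
  [/\ forall n, Uh N xs k (rho n),
      forall n l, Uh N xs k (g n l),
      forall n, {ae mu, forall x, Omega_x N xs x -> avg (g n ^~ x) = 0},
      forall n, scheme_rho dt (rho n) (rho n.+1) (g n.+1) &
      forall n, scheme_g dt (g n) (g n.+1) (rho n.+1)].

(* [tnorm2] and [tnorm_s2] are the squares |||g|||^2 and |||g|||_s^2. *)
Definition tnorm2 (g : 'I_Nv -> R -> R) : R :=
  avg (fun l => inner N xs (g l) (g l)).

Definition tnorm_s2 (g : 'I_Nv -> R -> R) : R :=
  avg (fun l => inner N xs (fun x => sigma_s x * g l x) (g l)).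

Definition energy (m dt : R) (rho : R -> R) (g : 'I_Nv -> R -> R) : R :=
  L2norm N xs rho ^+ 2 + eps ^+ 2 * tnorm2 g + (1 - m) * dt * tnorm_s2 g.

Definition mu_stable (dt m : R) : Prop :=
  forall (rho : nat -> R -> R) (g : nat -> 'I_Nv -> R -> R),
    numerical_solution dt rho g ->
    forall n, energy m dt (rho n.+1) (g n.+1) <= energy m dt (rho n) (g n).

Definition stable (dt : R) : Prop :=
  exists m : R, 0 <= m <= 1 /\ mu_stable dt m.

Definition unconditionally_stable : Prop := forall dt : R, 0 < dt -> stable dt.

End Scheme.

Definition v_sup {R : realType} (Omega_v : set R) : R :=
  sup [set `|v| | v in Omega_v].

(* Main.v *)
Require Import Defs.
From HB Require Import structures.
From mathcomp Require Import all_boot all_order all_algebra.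
From mathcomp Require Import all_classical all_reals all_analysis.
From mathcomp Require Import measurable_realfun ring lra.
Set Implicit Arguments.
Unset Strict Implicit.
Unset Printing Implicit Defensive.
Import Order.TTheory GRing.Theory Num.Theory.
Import numFieldNormedType.Exports.
Local Open Scope classical_set_scope.
Local Open Scope ring_scope.

(** Stability holds with [mu = 0], for which the energy contains the whole term
    [dt |||g|||_s^2], under one cell condition:
    [2 eps V dt <= h_i (2 eps^2 + sigma_m dt)] for every cell size [h_i], where
    [V] bounds the speeds.  Mesh regularity gives [delta h <= h_i], so it is
    enough that [dt (2 eps V / delta - sigma_m h) <= 2 eps^2 h].  When the
    bracket is nonpositive this is true for every [dt], which is part (i); when
    it is positive, dividing by it is the time step restriction of part (ii).

    For piecewise constants every form of the scheme is a finite sum over the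
    cells, with the periodic neighbour on the left given by [ord_pred]: the
    volume terms vanish because test functions are locally constant, traces are
    cell values, and node values do not matter since nodes are null sets.

    The energy estimate on these sums tests the density equation with the new
    density [r'] and the equation of speed [v_l] with its new solution [g'_l],
    weighted by [eps^2 omega_l].  The two coupling terms cancel by periodic
    summation by parts ([discrete_energy_decay]), the averaged part of the
    transport term vanishes because [g'] has zero velocity average, and
    absorption only dissipates.  What remains is the transport term, which is
    taken at the old time level and is the only possible source of energy.
    Upwinding bounds its contribution by [V |g' - g|^2] with no power of the mesh
    size ([upwind_dissipation]).  Two terms pay for that ([cell_energy]): the
    numerical dissipation [eps^2 h_i |g' - g|^2] of the implicit Euler step, and
    the scattering term.  The latter is where the choice of [mu] matters: with
    [mu = 0] the balance of scattering terms is
    [- dt sigma_s (g'^2 + g^2) <= - dt sigma_s (g' - g)^2 / 2], which controls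
    the increment even when [eps] is small. *)

(** * Energy estimate for the discrete equations *)

Section Disc.
Variables (R : realFieldType) (T : finType) (p : T -> T).
Hypothesis p_inj : injective p.

Lemma sum_sub_inj_eq0 (a : T -> R) : \sum_i (a i - a (p i)) = 0.
Proof. by rewrite sumrB (reindex_inj p_inj) /= subrr. Qed.

Definition upwind_value (v : R) (g : T -> R) i :=
  if 0 <= v then v * g (p i) else v * g i.

(** Replacing [g] by [g'] in the upwind flux gives minus half of the squared
    jumps of [g'], weighted by [|v|]; Young's inequality spends these jumps on
    the error [g' - g] committed by the replacement.  Cell by cell, the
    difference of the two sides is a square plus a telescoping term. *)
Lemma upwind_dissipation (v V : R) (g g' : T -> R) : `|v| <= V ->
  2 * \sum_i upwind_value v g i * (g' i - g' (p i)) <=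
  V * \sum_i (g' i - g i) ^+ 2.
Proof.
move=> vV; apply: (@le_trans _ _ (`|v| * \sum_i (g' i - g i) ^+ 2)); last first.
  by apply: ler_wpM2r => //; apply: sumr_ge0 => i _; exact: sqr_ge0.
pose s i := g' i ^+ 2.
suff : 2 * \sum_i upwind_value v g i * (g' i - g' (p i)) <=
    `|v| * \sum_i (g' i - g i) ^+ 2 + v * \sum_i (s i - s (p i)).
  by rewrite (sum_sub_inj_eq0 s) mulr0 addr0.
rewrite /upwind_value; have [v0|v0] := leP 0 v.
  (* For v >= 0 the flux at an interface involves the left cell, so the error
     has to be indexed by that cell too before comparing term by term. *)
  have -> : \sum_i (g' i - g i) ^+ 2 = \sum_i (g' (p i) - g (p i)) ^+ 2.
    exact: (reindex_inj p_inj).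
  rewrite ger0_norm// !mulr_sumr -big_split /=.
  apply: ler_sum => i _; rewrite /s -subr_ge0.
  have -> : v * (g' (p i) - g (p i)) ^+ 2 + v * (g' i ^+ 2 - g' (p i) ^+ 2) -
    2 * (v * g (p i) * (g' i - g' (p i))) = v * (g' i - g (p i)) ^+ 2 by ring.
  by rewrite mulr_ge0 ?sqr_ge0.
rewrite ltr0_norm// !mulr_sumr -big_split /=.
apply: ler_sum => i _; rewrite /s -subr_ge0.
have -> : - v * (g' i - g i) ^+ 2 + v * (g' i ^+ 2 - g' (p i) ^+ 2) -
  2 * (v * g i * (g' i - g' (p i))) = - v * (g' (p i) - g i) ^+ 2 by ring.
by rewrite mulr_ge0 ?sqr_ge0// oppr_ge0 ltW.
Qed.

(** Here [a] and [b] are the new and old values of one component of [g] in one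
    cell, and the term with [V] is the price of the explicit upwind flux.  The
    difference of the two sides is half of
    [(h (2 eps^2 + sm dt) - 2 eps V dt) (a - b)^2 + dt (S - sm h) (a - b)^2 +
    dt S (a + b)^2]. *)
Lemma cell_energy (eps dt V sm h S a b : R) :
  0 <= dt -> 0 <= S -> sm * h <= S ->
  2 * eps * V * dt <= h * (2 * eps ^+ 2 + sm * dt) ->
  eps ^+ 2 * (h * a ^+ 2 - h * b ^+ 2) +
    dt * (S * a ^+ 2 - S * b ^+ 2) +
    dt * eps * V * (a - b) ^+ 2 <=
  2 * eps ^+ 2 * (h * (a - b) * a) + 2 * dt * (S * a ^+ 2).
Proof.
move=> dt0 S0 hS c; rewrite -subr_ge0.
have -> : 2 * eps ^+ 2 * (h * (a - b) * a) + 2 * dt * (S * a ^+ 2) -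
    (eps ^+ 2 * (h * a ^+ 2 - h * b ^+ 2) + dt * (S * a ^+ 2 - S * b ^+ 2) +
     dt * eps * V * (a - b) ^+ 2) =
  2^-1 * ((h * (2 * eps ^+ 2 + sm * dt) - 2 * eps * V * dt) * (a - b) ^+ 2 +
   dt * (S - sm * h) * (a - b) ^+ 2 + dt * S * (a + b) ^+ 2)
  by field.
by rewrite mulr_ge0 ?invr_ge0// !addr_ge0// mulr_ge0 ?sqr_ge0 ?mulr_ge0
  ?subr_ge0.
Qed.

Section Step.
Variables (L : finType) (omega v : L -> R) (eps dt V sm : R).
(* [h], [S] and [A] are the cell sizes and the cell integrals of the scattering
   and absorption coefficients; [M] stands for the cell values of the averaged
   transport term, which are the same for every [l]. *)
Variables (h S A : T -> R) (r r' : T -> R) (g g' : L -> T -> R) (M : T -> R).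
Hypotheses (omega_ge0 : forall l, 0 <= omega l) (v_le : forall l, `|v l| <= V).
Hypotheses (eps_gt0 : 0 < eps) (dt_gt0 : 0 < dt).
Hypotheses (h_ge0 : forall i, 0 <= h i) (A_ge0 : forall i, 0 <= A i).
Hypotheses (S_ge0 : forall i, 0 <= S i) (S_ge : forall i, sm * h i <= S i).
Hypothesis cfl : forall i, 2 * eps * V * dt <= h i * (2 * eps ^+ 2 + sm * dt).

Let W i := \sum_l omega l * (v l * g' l i).

Hypothesis rho_eq :
  \sum_i h i * ((r' i - r i) / dt) * r' i - \sum_i W i * (r' i - r' (p i)) =
  - \sum_i A i * r' i ^+ 2.
Hypothesis g_eq : forall l,
  \sum_i h i * ((g' l i - g l i) / dt) * g' l i +
  eps^-1 * (- (\sum_i upwind_value (v l) (g l) i * (g' l i - g' l (p i))) -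
            \sum_i h i * M i * g' l i) -
  (eps ^+ 2)^-1 * (v l * \sum_i r' (p i) * (g' l i - g' l (p i))) =
  - ((eps ^+ 2)^-1 * \sum_i S i * g' l i ^+ 2) - \sum_i A i * g' l i ^+ 2.
Hypothesis avg0 : forall i, \sum_l omega l * g' l i = 0.

Let rho_step : \sum_i h i * r' i ^+ 2 - \sum_i h i * r i ^+ 2 <=
  2 * dt * \sum_i W i * (r' i - r' (p i)).
Proof.
have A0 : 0 <= \sum_i A i * r' i ^+ 2.
  by apply: sumr_ge0 => i _; rewrite mulr_ge0 ?sqr_ge0.
have dtX : dt * (\sum_i h i * ((r' i - r i) / dt) * r' i) =
           \sum_i h i * (r' i - r i) * r' i.
  by rewrite mulr_sumr; apply: eq_bigr => i _; field; rewrite gt_eqF.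
have le1 : \sum_i h i * r' i ^+ 2 - \sum_i h i * r i ^+ 2 <=
    2 * \sum_i h i * (r' i - r i) * r' i.
  rewrite mulr_sumr -sumrB; apply: ler_sum => i _; rewrite -subr_ge0.
  have -> : 2 * (h i * (r' i - r i) * r' i) -
    (h i * r' i ^+ 2 - h i * r i ^+ 2) = h i * (r' i - r i) ^+ 2 by ring.
  by rewrite mulr_ge0 ?sqr_ge0.
apply: (le_trans le1); rewrite -dtX -mulrA ler_pM2l// ler_pM2l//.
by rewrite -subr_le0 rho_eq oppr_le0.
Qed.

Let g_step l :
  eps ^+ 2 * (\sum_i h i * g' l i ^+ 2 - \sum_i h i * g l i ^+ 2) +
  dt * (\sum_i S i * g' l i ^+ 2 - \sum_i S i * g l i ^+ 2) <=
  2 * dt * eps * (\sum_i h i * M i * g' l i) +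
  2 * dt * (v l * \sum_i r' (p i) * (g' l i - g' l (p i))).
Proof.
have A0 : 0 <= \sum_i A i * g' l i ^+ 2.
  by apply: sumr_ge0 => i _; rewrite mulr_ge0 ?sqr_ge0.
set X := \sum_i h i * (g' l i - g l i) * g' l i.
have dtX : \sum_i h i * ((g' l i - g l i) / dt) * g' l i = dt^-1 * X.
  by rewrite mulr_sumr; apply: eq_bigr => i _; field; rewrite gt_eqF.
have up := @upwind_dissipation (v l) V (g l) (g' l) (v_le l).
have cell : eps ^+ 2 * (\sum_i h i * g' l i ^+ 2 - \sum_i h i * g l i ^+ 2) +
    dt * (\sum_i S i * g' l i ^+ 2 - \sum_i S i * g l i ^+ 2) +
    dt * eps * (V * \sum_i (g' l i - g l i) ^+ 2) <=
    2 * eps ^+ 2 * X + 2 * dt * \sum_i S i * g' l i ^+ 2.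
  rewrite /X mulrA -!sumrB !mulr_sumr -!big_split /=; apply: ler_sum => i _.
  by apply: (@cell_energy _ _ _ sm) => //; exact: ltW.
have := g_eq l; rewrite dtX => /(congr1 (fun x => 2 * dt * eps ^+ 2 * x)).
move: X up cell A0 {dtX} => X.
set F := \sum_i upwind_value _ _ _ * _; set D := \sum_i (_ - _) ^+ 2.
set Mg := \sum_i h i * M i * _; set P := v l * _.
set G' := \sum_i h i * g' l i ^+ 2; set G := \sum_i h i * g l i ^+ 2.
set S' := \sum_i S i * g' l i ^+ 2; set S0 := \sum_i S i * g l i ^+ 2.
set Ag := \sum_i A i * _ => up cell A0.
have -> : 2 * dt * eps ^+ 2 *
  (dt^-1 * X + eps^-1 * (- F - Mg) - (eps ^+ 2)^-1 * P) =
  2 * eps ^+ 2 * X - dt * eps * (2 * F) - 2 * dt * eps * Mg - 2 * dt * P.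
  by field; rewrite !gt_eqF.
have -> : 2 * dt * eps ^+ 2 * (- ((eps ^+ 2)^-1 * S') - Ag) =
  - (2 * dt * S') - 2 * (dt * eps ^+ 2 * Ag).
  by field; rewrite !gt_eqF.
have : dt * eps * (2 * F) <= dt * eps * (V * D) by rewrite ler_pM2l// mulr_gt0.
have : 0 <= dt * eps ^+ 2 * Ag by rewrite !mulr_ge0// ltW.
move: cell; lra.
Qed.

(** Weighted by [omega_l] and summed over [l], the last term of [g_step] is the
    opposite of the bound in [rho_step], and the one with [M] is a multiple of
    the velocity average of [g']. *)
Theorem discrete_energy_decay :
  \sum_i h i * r' i ^+ 2 +
    eps ^+ 2 * (\sum_l omega l * \sum_i h i * g' l i ^+ 2) +
    dt * (\sum_l omega l * \sum_i S i * g' l i ^+ 2) <=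
  \sum_i h i * r i ^+ 2 +
    eps ^+ 2 * (\sum_l omega l * \sum_i h i * g l i ^+ 2) +
    dt * (\sum_l omega l * \sum_i S i * g l i ^+ 2).
Proof.
have Mg0 : \sum_l omega l * (\sum_i h i * M i * g' l i) = 0.
  under eq_bigr do rewrite mulr_sumr.
  rewrite exchange_big /= big1// => i _.
  by under eq_bigr do rewrite mulrCA; rewrite -mulr_sumr avg0 mulr0.
have ibp : \sum_l omega l * (v l * \sum_i r' (p i) * (g' l i - g' l (p i))) =
    - \sum_i W i * (r' i - r' (p i)).
  have -> : \sum_l omega l * (v l * \sum_i r' (p i) * (g' l i - g' l (p i))) =
      \sum_i r' (p i) * (W i - W (p i)).
    under eq_bigr do rewrite mulrA mulr_sumr.
    rewrite exchange_big /=; apply: eq_bigr => i _.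
    by rewrite /W -sumrB mulr_sumr; apply: eq_bigr => l _; ring.
  apply/eqP; rewrite -addr_eq0 -big_split /=.
  rewrite -[X in _ == X](sum_sub_inj_eq0 (fun i => W i * r' i)).
  by apply/eqP/eq_bigr => i _; ring.
pose lhs l :=
  eps ^+ 2 * (\sum_i h i * g' l i ^+ 2 - \sum_i h i * g l i ^+ 2) +
  dt * (\sum_i S i * g' l i ^+ 2 - \sum_i S i * g l i ^+ 2).
pose rhs l :=
  2 * dt * eps * (\sum_i h i * M i * g' l i) +
  2 * dt * (v l * \sum_i r' (p i) * (g' l i - g' l (p i))).
have gs : \sum_l omega l * lhs l <= \sum_l omega l * rhs l.
  by apply: ler_sum => l _; rewrite ler_wpM2l// /lhs /rhs g_step.
have eR : \sum_l omega l * rhs l = - (2 * dt * \sum_i W i * (r' i - r' (p i))).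
  have -> : - (2 * dt * \sum_i W i * (r' i - r' (p i))) =
      2 * dt * eps * (\sum_l omega l * (\sum_i h i * M i * g' l i)) +
      2 * dt * (\sum_l omega l * (v l * \sum_i r' (p i) * (g' l i - g' l (p i)))).
    by rewrite Mg0 ibp mulr0 add0r mulrN.
  rewrite 2![_ * (\sum_l _)]mulr_sumr -big_split.
  by apply: eq_bigr => l _ /=; rewrite /rhs; ring.
have eL : \sum_l omega l * lhs l =
  eps ^+ 2 * (\sum_l omega l * \sum_i h i * g' l i ^+ 2) +
  dt * (\sum_l omega l * \sum_i S i * g' l i ^+ 2) -
  (eps ^+ 2 * (\sum_l omega l * \sum_i h i * g l i ^+ 2) +
  dt * (\sum_l omega l * \sum_i S i * g l i ^+ 2)).
  rewrite !mulr_sumr -!big_split -sumrB.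
  by apply: eq_bigr => l _ /=; rewrite /lhs; ring.
move: gs rho_step; rewrite eR eL; lra.
Qed.
End Step.
End Disc.

(** * Piecewise constants on the mesh *)

Section Mesh.
Variables (R : realType) (N : nat) (xs : nat -> R).
Hypothesis xs_lt : forall i : nat, (i < N)%N -> xs i < xs i.+1.
Notation mu := (@lebesgue_measure R).
Local Notation Uh0 := (Uh N xs 0).

(** Membership in the discrete space only fixes a function on the open cells, so
    its constant is read off at the midpoint rather than at a node. *)
Definition cell_value (u : R -> R) (i : 'I_N) : R := u ((xs i + xs i.+1) / 2).

Lemma Uh0P (u : R -> R) : Uh0 u <->
  forall i : 'I_N, forall x, xs i < x < xs i.+1 -> u x = cell_value u i.
Proof.
split=> [uU i x xi|uc i].
  have [q sq qu] := uU i; rewrite /cell_value !qu//.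
    by rewrite (size1_polyC sq) !hornerC.
  by have := xs_lt (ltn_ord i); lra.
exists (cell_value u i)%:P; first exact: size_polyC_leq1.
by move=> x xi; rewrite hornerC (uc i).
Qed.

Lemma Uh0_of (u : R -> R) (c : 'I_N -> R) :
  (forall i : 'I_N, forall x, xs i < x < xs i.+1 -> u x = c i) -> Uh0 u.
Proof.
move=> uc i; exists (c i)%:P; first exact: size_polyC_leq1.
by move=> x /(uc i) ->; rewrite hornerC.
Qed.

Lemma integrable_itv_bndoo (a b : R) (b0 b1 : bool) (f : R -> \bar R) :
  mu.-integrable `]a, b[ f ->
  mu.-integrable [set` Interval (BSide b0 a) (BSide b1 b)] f.
Proof.
move=> /integrableP[mf fi]; apply/integrableP; split.
  have mcc := emeasurable_fun_itv_cc mf.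
  apply: measurable_funS mcc => //.
  by move=> x /=; apply: subitvP; rewrite subitvE !bnd_simp; case: b0 b1 => [] [].
by rewrite integral_itv_bndoo//; exact: measurableT_comp.
Qed.

Lemma integrable_setU (A B : set R) (f : R -> \bar R) :
  measurable A -> measurable B -> [disjoint A & B] ->
  mu.-integrable A f -> mu.-integrable B f -> mu.-integrable (A `|` B) f.
Proof.
move=> mA mB AB /integrableP[mfA fA] /integrableP[mfB fB]; apply/integrableP.
have mf : measurable_fun (A `|` B) f by exact/measurable_funU.
split=> //; rewrite integral_setU//; last exact: measurableT_comp.
exact: lte_add_pinfty.
Qed.

(** The nodes, where [f] is arbitrary, are null: this makes [f] integrable as well
    as giving the value of the integral.  In applications [f] is the integrand
    of an inner product, with [w] equal to 1 or to one of the two coefficients, or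
    a volume term, with [w] equal to 0. *)
Lemma integral_cell (w f : R -> R) (c : R) (i : 'I_N) :
  mu.-integrable (cell xs i) (EFin \o w) ->
  (forall x, xs i < x < xs i.+1 -> f x = w x * c) ->
  mu.-integrable (cell xs i) (EFin \o f) /\
  \int[mu]_(x in cell xs i) f x = (\int[mu]_(x in cell xs i) w x) * c.
Proof.
move=> iw fE.
have iwo : mu.-integrable `]xs i, xs i.+1[ (EFin \o w).
  by apply: integrableS iw => //;
    [exact: measurable_itv|move=> x; exact: subset_itv_oo_cc].
have fwo : {in `]xs i, xs i.+1[%classic, f =1 (fun x => w x * c)}.
  by move=> x; rewrite inE/= in_itv/= => /fE.
have ifo : mu.-integrable `]xs i, xs i.+1[ (EFin \o f).
  have := @integrableZr _ _ _ mu _ (measurable_itv _) c _ iwo.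
  by apply: eq_integrable => // x xi /=; rewrite fwo// EFinM.
split; first exact: integrable_itv_bndoo.
have oo (k : R -> R) : mu.-integrable `]xs i, xs i.+1[ (EFin \o k) ->
    \int[mu]_(x in cell xs i) k x = \int[mu]_(x in `]xs i, xs i.+1[) k x.
  by move=> /measurable_int mk; rewrite /Rintegral integral_itv_bndoo.
by rewrite !oo// (eq_Rintegral mu fwo) RintegralZr.
Qed.

Lemma integral_Omega (f : R -> R) :
  (forall i : 'I_N, mu.-integrable (cell xs i) (EFin \o f)) ->
  \int[mu]_(x in Omega_x N xs) f x = \sum_(i < N) \int[mu]_(x in cell xs i) f x.
Proof.
move=> fi.
suff main (n : nat) : (n <= N)%N -> xs 0%N <= xs n /\
    mu.-integrable `[xs 0%N, xs n] (EFin \o f) /\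
    \int[mu]_(x in `[xs 0%N, xs n]) f x =
      \sum_(i < n) \int[mu]_(x in `[xs i, xs i.+1]) f x.
  by have [_ []] := main N (leqnn N).
elim: n => [_|n IH nN].
  rewrite big_ord0 set_itv1 Rintegral_set1 lexx; split => //; split => //.
  apply/integrableP; split; first exact: measurable_fun_set1.
  by rewrite integral_set1.
have [le0n [in0 eqn]] := IH (ltnW nN).
have ltn := xs_lt nN.
have icc := fi (Ordinal nN).
have ioc : mu.-integrable `]xs n, xs n.+1] (EFin \o f).
  by apply: integrableS icc => //;
    [exact: measurable_itv|move=> x; exact: subset_itv_oc_cc].
have U : `[xs 0%N, xs n.+1]%classic = `[xs 0%N, xs n] `|` `]xs n, xs n.+1].
  by rewrite -itv_bndbnd_setU// bnd_simp// ltW.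
have D : [disjoint `[xs 0%N, xs n]%classic & `]xs n, xs n.+1]%classic].
  apply/disj_setPS => y [/=]; rewrite 2!in_itv/= => /andP[_ yx] /andP[].
  by rewrite ltNge yx.
split; first by rewrite (le_trans le0n)// ltW.
have iU := integrable_setU _ _ D in0 ioc.
rewrite U; split; first exact: iU.
rewrite Rintegral_setU//; last exact: iU.
by rewrite big_ord_recr/= -eqn Rintegral_itv_obnd_cbnd.
Qed.

Lemma integral_derive1 (rho psi : R -> R) (i : 'I_N) : Uh0 psi ->
  \int[mu]_(x in cell xs i) (rho x * derive1 psi x) = 0.
Proof.
move=> /Uh0P pU.
have i0 : mu.-integrable (cell xs i) (EFin \o cst 0) by exact: integrable0.
have [|_ ->] := @integral_cell (cst 0) (fun x => rho x * derive1 psi x) 0 i i0.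
  move=> x xi; rewrite mulr0 derive1E.
  rewrite (@near_eq_derive _ _ _ _ (cst (cell_value psi i))) ?derive_cst ?mulr0//.
  near=> y; apply: (pU i).
  have : y \in `]xs i, xs i.+1[ by near: y; exact: near_in_itvoo.
  by rewrite in_itv.
by rewrite mulr0.
Unshelve. all: by end_near. Qed.

Lemma trace_plusE (u : R -> R) (i : 'I_N) :
  Uh0 u -> trace_plus xs u i = cell_value u i.
Proof.
move=> /Uh0P uU; apply/cvg_lim => //; apply: cvg_near_cst.
near=> x; apply: (uU i); apply/andP; split.
  near: x; exact: nbhs_right_gt.
by near: x; apply: nbhs_right_lt; exact: xs_lt.
Unshelve. all: by end_near. Qed.

Lemma trace_minusE (u : R -> R) (i : 'I_N) :
  Uh0 u -> trace_minus xs u i = cell_value u (ord_pred i).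
Proof.
move=> /Uh0P uU; rewrite /trace_minus.
have N0 : (0 < N)%N by case: (N) i => // -[].
have -> : (if i == 0%N :> nat then N else i) = (ord_pred i).+1.
  rewrite /=; case: eqP => [->|/eqP i0].
    by rewrite add0n modn_small ?prednK.
  have i_gt0 : (0 < i)%N by rewrite lt0n.
  by rewrite -subn1 -addnBAC// subn1 modnDr modn_small ?prednK// ltnW.
apply/cvg_lim => //; apply: cvg_near_cst.
near=> x; apply: (uU (ord_pred i)); apply/andP; split; last first.
  near: x; exact: nbhs_left_lt.
by near: x; apply: nbhs_left_gt; exact: xs_lt.
Unshelve. all: by end_near. Qed.

Lemma nodes_le (i j : nat) : (i <= j)%N -> (j <= N)%N -> xs i <= xs j.
Proof.
elim: j => [|j IH]; first by rewrite leqn0 => /eqP ->.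
rewrite leq_eqVlt => /predU1P[-> //|]; rewrite ltnS => ij jN.
by rewrite (le_trans (IH ij (ltnW jN)))// ltW// xs_lt.
Qed.

Lemma open_cell_inj (i j : 'I_N) (x : R) :
  xs i < x < xs i.+1 -> xs j < x < xs j.+1 -> i = j.
Proof.
move=> /andP[ix xi] /andP[jx xj]; apply/val_inj => /=; apply/eqP.
rewrite eqn_leq; apply/andP; split; rewrite leqNgt; apply/negP => ij.
- by have := nodes_le ij (ltnW (ltn_ord i)); rewrite leNgt (lt_trans ix).
- by have := nodes_le ij (ltnW (ltn_ord j)); rewrite leNgt (lt_trans jx).
Qed.

Lemma exists_piecewise (c : 'I_N -> R) :
  exists u : R -> R, forall (i : 'I_N) x, xs i < x < xs i.+1 -> u x = c i.
Proof.
exists (fun x =>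
  if [pick i : 'I_N | xs i < x < xs i.+1] is Some i then c i else 0).
move=> i x xi; case: pickP => [j xj|/(_ i)]; last by rewrite xi.
by rewrite (open_cell_inj xi xj).
Qed.

Lemma cell_valueE (u : R -> R) (c : 'I_N -> R) (i : 'I_N) :
  (forall (i : 'I_N) x, xs i < x < xs i.+1 -> u x = c i) -> cell_value u i = c i.
Proof. by move=> uc; apply: uc; have := xs_lt (ltn_ord i); lra. Qed.

Lemma measure_cell (i : 'I_N) : fine (mu (cell xs i)) = cell_size xs i.
Proof. by rewrite lebesgue_measure_itv/= lte_fin xs_lt. Qed.

Lemma integral_piecewise (w f : R -> R) (c : 'I_N -> R) :
  (forall i : 'I_N, mu.-integrable (cell xs i) (EFin \o w)) ->
  (forall (i : 'I_N) x, xs i < x < xs i.+1 -> f x = w x * c i) ->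
  \int[mu]_(x in Omega_x N xs) f x =
    \sum_(i < N) (\int[mu]_(x in cell xs i) w x) * c i.
Proof.
move=> iw fc; rewrite integral_Omega => [|i].
  by apply: eq_bigr => i _; have [_ ->] := integral_cell (iw i) (fc i).
by have [] := integral_cell (iw i) (fc i).
Qed.

Lemma inner_piecewise (u psi : R -> R) (c : 'I_N -> R) :
  (forall (i : 'I_N) x, xs i < x < xs i.+1 -> u x = c i) -> Uh0 psi ->
  inner N xs u psi = \sum_(i < N) cell_size xs i * c i * cell_value psi i.
Proof.
move=> uc /Uh0P pU.
have mcell (i : 'I_N) : mu (cell xs i) = (cell_size xs i)%:E.
  by rewrite lebesgue_measure_itv/= lte_fin xs_lt.
rewrite /inner (@integral_piecewise (cst 1) _ (fun i => c i * cell_value psi i)).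
- apply: eq_bigr => i _; rewrite Rintegral_cst; last exact: measurable_itv.
  by rewrite mul1r -mulrA; congr (_ * _); exact: (congr1 fine (mcell i)).
- move=> i; apply: measurable_bounded_integrable => //=.
  + exact: measurable_itv.
  + by rewrite [X in (X < _)%E]mcell ltry.
  + exact: bounded_cst.
- by move=> i x xi; rewrite mul1r (uc i)// (pU i).
Qed.

Lemma inner_weighted (w u psi : R -> R) :
  (forall i : 'I_N, mu.-integrable (cell xs i) (EFin \o w)) -> Uh0 u -> Uh0 psi ->
  inner N xs (fun x => w x * u x) psi =
  \sum_(i < N) (\int[mu]_(x in cell xs i) w x) *
    (cell_value u i * cell_value psi i).
Proof.
move=> iw /Uh0P uU /Uh0P pU; apply: integral_piecewise => // i x xi.
by rewrite (uU i)// (pU i)// mulrA.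
Qed.

(** * Forms of the scheme as sums over the cells *)

Lemma jumpE (psi : R -> R) (i : 'I_N) : Uh0 psi ->
  jump xs psi i = cell_value psi i - cell_value psi (ord_pred i).
Proof. by move=> pU; rewrite /jump trace_plusE// trace_minusE. Qed.

Lemma d_hE (rho psi : R -> R) : Uh0 rho -> Uh0 psi ->
  d_h N xs rho psi = \sum_(i < N) cell_value rho (ord_pred i) *
    (cell_value psi i - cell_value psi (ord_pred i)).
Proof.
move=> rU pU; rewrite /d_h big1 ?add0r => [|i _]; last exact: integral_derive1.
by apply: eq_bigr => i _; rewrite trace_minusE// jumpE.
Qed.

Lemma l_hE (w phi : R -> R) : Uh0 w -> Uh0 phi ->
  l_h N xs w phi = - \sum_(i < N) cell_value w i *
    (cell_value phi i - cell_value phi (ord_pred i)).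
Proof.
move=> wU pU; rewrite /l_h big1 ?oppr0 ?add0r => [|i _]; last first.
  exact: integral_derive1.
by congr (- _); apply: eq_bigr => i _; rewrite trace_plusE// jumpE.
Qed.

Lemma upwind_fluxE (g : R -> R) (v : R) (i : 'I_N) : Uh0 g ->
  upwind_flux xs g v i = upwind_value (@ord_pred N) v (cell_value g) i.
Proof. by move=> gU; rewrite /upwind_flux trace_minusE// trace_plusE. Qed.

(** The transport operator is the flux difference divided by the cell size:
    periodic summation by parts moves the difference from the test function to
    the flux. *)
Lemma D_upP (g : R -> R) (v : R) : is_D_up N xs 0 g v (D_up N xs 0 g v).
Proof.
rewrite /D_up; apply: getPex => /=.
pose F (i : 'I_N) := upwind_flux xs g v i.
have [D DE] := exists_piecewise (fun i => (F (ordS i) - F i) / cell_size xs i).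
exists D; split; first exact: Uh0_of DE.
move=> psi pU; rewrite (inner_piecewise DE pU).
rewrite [X in - X - _]big1 ?oppr0 ?add0r => [|i _]; last first.
  exact: (integral_derive1 (fun x => v * g x)).
under [in RHS]eq_bigr do rewrite jumpE// mulrBr.
rewrite sumrB opprB [X in _ = X - _](reindex_inj (@ordS_inj N)) /= -sumrB.
apply: eq_bigr => i _; rewrite ordSK /F; field.
by rewrite gt_eqF// subr_gt0 xs_lt.
Qed.

Lemma inner_D_up (g psi : R -> R) (v : R) : Uh0 g -> Uh0 psi ->
  inner N xs (D_up N xs 0 g v) psi =
  - \sum_(i < N) upwind_value (@ord_pred N) v (cell_value g) i *
    (cell_value psi i - cell_value psi (ord_pred i)).
Proof.
move=> gU pU; have [_ ->//] := D_upP g v.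
rewrite big1 ?oppr0 ?add0r => [|i _]; last first.
  exact: (integral_derive1 (fun x => v * g x)).
by congr (- _); apply: eq_bigr => i _; rewrite upwind_fluxE// jumpE.
Qed.

(** A constant that vanishes almost everywhere on a cell vanishes, since cells
    have positive measure. *)
Lemma ae_zero_cell (f : R -> R) (c : R) (i : 'I_N) :
  {ae mu, forall x, Omega_x N xs x -> f x = 0} ->
  (forall x, xs i < x < xs i.+1 -> f x = c) -> c = 0.
Proof.
move=> f0 fc; apply/eqP; apply: contrapT => /negP c0.
have neg : mu.-negligible `]xs i, xs i.+1[.
  apply: negligibleS f0 => x /= xi fx0; have xi' := xi.
  rewrite in_itv/= in xi'; move: c0; rewrite -(fc x xi') fx0 ?eqxx//.
  move/andP: xi' => [ix xi']; rewrite /Omega_x/= in_itv/=; apply/andP; split.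
    by rewrite (le_trans _ (ltW ix))// nodes_le// ltnW.
  by rewrite (le_trans (ltW xi'))// nodes_le.
have : mu (`]xs i, xs i.+1[ : set R) = 0%E.
  exact: (measure_negligible _ neg).
rewrite lebesgue_measure_itv/= lte_fin xs_lt// => /eqP.
by rewrite -EFinB eqe subr_eq0 gt_eqF// xs_lt.
Qed.

End Mesh.

(** * Stability of the scheme *)

Section Scheme.
Variables (R : realType) (N : nat) (xs : nat -> R).
Hypothesis xs_lt : forall i : nat, (i < N)%N -> xs i < xs i.+1.
Variables (Nv : nat) (omega v : 'I_Nv -> R) (eps V sm : R).
Variables (sigma_s sigma_a : R -> R).
Hypotheses (omega_ge0 : forall l, 0 <= omega l) (v_le : forall l, `|v l| <= V).
Hypothesis eps_gt0 : 0 < eps.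
Notation mu := (@lebesgue_measure R).
Hypotheses (s_int : forall i : 'I_N, mu.-integrable (cell xs i) (EFin \o sigma_s))
  (a_int : forall i : 'I_N, mu.-integrable (cell xs i) (EFin \o sigma_a)).
Let S (i : 'I_N) := \int[mu]_(x in cell xs i) sigma_s x.
Let A (i : 'I_N) := \int[mu]_(x in cell xs i) sigma_a x.
Hypotheses (A_ge0 : forall i, 0 <= A i) (S_ge0 : forall i, 0 <= S i).
Hypothesis S_ge : forall i, sm * cell_size xs i <= S i.
Local Notation Uh0 := (Uh N xs 0).

Lemma energyE (m dt : R) (rho : R -> R) (g : 'I_Nv -> R -> R) :
  Uh0 rho -> (forall l, Uh0 (g l)) ->
  energy N xs omega eps sigma_s m dt rho g =
  \sum_(i < N) cell_size xs i * cell_value xs rho i ^+ 2 +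
  eps ^+ 2 *
    (\sum_l omega l * \sum_(i < N) cell_size xs i * cell_value xs (g l) i ^+ 2) +
  (1 - m) * dt * (\sum_l omega l * \sum_(i < N) S i * cell_value xs (g l) i ^+ 2).
Proof.
move=> rU gU.
have innerE u : Uh0 u ->
    inner N xs u u = \sum_(i < N) cell_size xs i * cell_value xs u i ^+ 2.
  move=> uU; rewrite (inner_piecewise xs_lt ((Uh0P xs_lt u).1 uU) uU).
  by apply: eq_bigr => i _; rewrite expr2 mulrA.
rewrite /energy /L2norm sqr_sqrtr innerE//; last first.
  by apply: sumr_ge0 => i _; rewrite mulr_ge0 ?sqr_ge0// subr_ge0 ltW// xs_lt.
congr (_ + _ * _ + _ * _); apply: eq_bigr => l _; congr (_ * _).
  exact: innerE.
by rewrite inner_weighted//; apply: eq_bigr => i _; rewrite expr2.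
Qed.

(** The new density and the new [g_l] are admissible test functions, and with them
    the two equations of the scheme become the hypotheses of the discrete
    estimate. *)
Lemma scheme_mu0_stable (dt : R) : 0 < dt ->
  (forall i : 'I_N,
    2 * eps * V * dt <= cell_size xs i * (2 * eps ^+ 2 + sm * dt)) ->
  mu_stable 0 N xs omega v eps sigma_s sigma_a dt 0.
Proof.
move=> dt_gt0 cfl rho g [rU gU g0 eq_rho eq_g] n.
rewrite !energyE// subr0 mul1r.
have rP n := (Uh0P xs_lt _).1 (rU n); have gP n l := (Uh0P xs_lt _).1 (gU n l).
have WP : forall (i : 'I_N) x, xs i < x < xs i.+1 ->
    avg omega (fun l => v l * g n.+1 l x) =
    \sum_l omega l * (v l * cell_value xs (g n.+1 l) i).
  by move=> i x xi; apply: eq_bigr => l _; rewrite (gP _ _ i).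
pose M (i : 'I_N) :=
  \sum_l omega l * cell_value xs (D_up N xs 0 (g n l) (v l)) i.
have MP : forall (i : 'I_N) x, xs i < x < xs i.+1 ->
    avg omega (fun l => D_up N xs 0 (g n l) (v l) x) = M i.
  move=> i x xi; apply: eq_bigr => l _; congr (_ * _).
  by have [/(Uh0P xs_lt)/(_ i x xi) ] := D_upP xs_lt (g n l) (v l).
apply: (@discrete_energy_decay _ _ (@ord_pred N) (@ord_pred_inj N) _ omega v
  eps dt V sm (cell_size xs) S A _ _ _ _ M) => //.
- by move=> i; rewrite subr_ge0 ltW// xs_lt.
- have := eq_rho n (rho n.+1) (rU n.+1).
  rewrite (@inner_piecewise _ _ _ xs_lt _ _ (fun i =>
    (cell_value xs (rho n.+1) i - cell_value xs (rho n) i) / dt))//; last first.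
    by move=> i x xi; rewrite !(rP _ i).
  rewrite (l_hE xs_lt); [|exact: Uh0_of WP|exact: rU].
  by rewrite (inner_weighted xs_lt a_int).
- move=> l; have := eq_g n (g n.+1 l) l (gU n.+1 l).
  rewrite /b_hv (@inner_piecewise _ _ _ xs_lt _ _ (fun i =>
    (cell_value xs (g n.+1 l) i - cell_value xs (g n l) i) / dt))//; last first.
    by move=> i x xi; rewrite !(gP _ _ i).
  by rewrite inner_D_up// (inner_piecewise xs_lt MP)// d_hE// !inner_weighted.
- move=> i; apply: (ae_zero_cell xs_lt (i := i) (g0 n.+1)) => x xi.
  by apply: eq_bigr => l _; rewrite (gP _ _ i).
Qed.

End Scheme.

Theorem theorem5p4 (R : realType)
  (N : nat) (xs : nat -> R) (delta : R)
  (N_gt0 : (0 < N)%N)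
  (xs_lt : forall i : nat, (i < N)%N -> xs i < xs i.+1)
  (delta_gt0 : 0 < delta)
  (mesh_regular : forall i : 'I_N, delta <= cell_size xs i / mesh_size N xs)
  (Omega_v : set R) (Omega_v_bounded : bounded_set Omega_v)
  (v_sup_gt0 : 0 < v_sup Omega_v)
  (Nv : nat) (v omega : 'I_Nv -> R)
  (v_in : forall l, Omega_v (v l)) (omega_ge0 : forall l, 0 <= omega l)
  (eps : R) (eps_gt0 : 0 < eps)
  (sigma_s sigma_a : R -> R) (sigma_m : R)
  (sigma_s_meas : measurable_fun (Omega_x N xs) sigma_s)
  (sigma_a_meas : measurable_fun (Omega_x N xs) sigma_a)
  (sigma_s_bounded : [bounded sigma_s x | x in Omega_x N xs])
  (sigma_a_bounded : [bounded sigma_a x | x in Omega_x N xs])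
  (sigma_a_ge0 : forall x, Omega_x N xs x -> 0 <= sigma_a x)
  (sigma_m_gt0 : 0 < sigma_m)
  (sigma_s_ge : forall x, Omega_x N xs x -> sigma_m <= sigma_s x) :
  let h := mesh_size N xs in
  (eps / (sigma_m * h) <= delta / (2 * v_sup Omega_v) ->
     unconditionally_stable 0 N xs omega v eps sigma_s sigma_a) /\
  (~ (eps / (sigma_m * h) <= delta / (2 * v_sup Omega_v)) ->
     forall dt : R,
       0 < dt <= 2 * eps ^+ 2 * h /
                 (2 * eps * v_sup Omega_v / delta - sigma_m * h) ->
       stable 0 N xs omega v eps sigma_s sigma_a dt).
Proof.
move=> h; have i0 := Ordinal N_gt0; set V := v_sup Omega_v in v_sup_gt0 *.
have v_le l : `|v l| <= V.
  apply: sup_upper_bound; last by exists (v l).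
  split; first by exists `|v l|, (v l).
  have [M [_ MP]] := Omega_v_bounded.
  by exists (M + 1) => _ [w Ow <-]; apply: (MP (M + 1)) => //; rewrite ltrDl.
have size_gt0 (i : 'I_N) : 0 < cell_size xs i by rewrite subr_gt0 xs_lt.
have h_gt0 : 0 < h.
  by apply: (lt_le_trans (size_gt0 i0)); exact: le_bigmax.
have size_ge (i : 'I_N) : delta * h <= cell_size xs i.
  by rewrite -ler_pdivlMr// mesh_regular.
have cell_sub (i : 'I_N) : cell xs i `<=` Omega_x N xs.
  move=> x; rewrite /cell /Omega_x/= !in_itv/= => /andP[ix xi]; apply/andP; split.
    by rewrite (le_trans _ ix)// (nodes_le xs_lt)// ltnW.
  by rewrite (le_trans xi)// (nodes_le xs_lt).
have bounded_int (s : R -> R) (i : 'I_N) : measurable_fun (Omega_x N xs) s ->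
    [bounded s x | x in Omega_x N xs] ->
    (@lebesgue_measure R).-integrable (cell xs i) (EFin \o s).
  move=> ms bs.
  have int_s : (@lebesgue_measure R).-integrable (Omega_x N xs) (EFin \o s).
    apply: measurable_bounded_integrable => //; first exact: measurable_itv.
    by rewrite [X in (X < _)%E]lebesgue_measure_itv/=; case: ifP => _;
      rewrite ?ltry// -EFinB ltry.
  apply: integrableS int_s; [exact: measurable_itv|exact: measurable_itv|].
  exact: cell_sub.
have S_ge (i : 'I_N) : sigma_m * cell_size xs i <=
    \int[@lebesgue_measure R]_(x in cell xs i) sigma_s x.
  have -> : sigma_m * cell_size xs i =
      \int[@lebesgue_measure R]_(x in cell xs i) cst sigma_m x.
    rewrite Rintegral_cst; last exact: measurable_itv.
    by rewrite -(measure_cell xs_lt).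
  apply: le_Rintegral => [|||x /cell_sub];
    [exact: measurable_itv| | |exact: sigma_s_ge].
    by apply: bounded_int; [exact: measurable_cst|exact: bounded_cst].
  exact: bounded_int.
have stab (dt : R) : 0 < dt ->
    dt * (2 * eps * V / delta - sigma_m * h) <= 2 * eps ^+ 2 * h ->
    stable 0 N xs omega v eps sigma_s sigma_a dt.
  move=> dt0 cfl; exists 0; split; first by rewrite lexx ler01.
  apply: (@scheme_mu0_stable _ _ _ xs_lt _ _ _ _ V sigma_m) => //.
  - by move=> i; exact: bounded_int.
  - by move=> i; exact: bounded_int.
  - by move=> i; apply: Rintegral_ge0 => x /cell_sub /sigma_a_ge0.
  - move=> i; apply: Rintegral_ge0 => x /cell_sub /sigma_s_ge.
    exact/le_trans/ltW.
  - move=> i; have c_gt0 : 0 < 2 * eps ^+ 2 + sigma_m * dt.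
      by rewrite addr_gt0 ?mulr_gt0// exprn_gt0.
    apply: (@le_trans _ _ (delta * h * (2 * eps ^+ 2 + sigma_m * dt))); last first.
      by rewrite ler_pM2r.
    move: cfl; rewrite -(ler_pM2l delta_gt0).
    have -> : delta * (dt * (2 * eps * V / delta - sigma_m * h)) =
      2 * eps * V * dt - delta * h * (sigma_m * dt) by field; rewrite gt_eqF.
    by lra.
have ratio : (eps / (sigma_m * h) <= delta / (2 * V)) =
    (2 * eps * V / delta - sigma_m * h <= 0).
  rewrite subr_le0 ler_pdivrMr ?mulr_gt0// ler_pdivrMr// mulrAC.
  rewrite ler_pdivlMr ?mulr_gt0//.
  by rewrite [delta * _]mulrC mulrCA mulrA.
rewrite ratio; split=> [le0 dt dt0|/negP].
  apply: stab => //; apply: (@le_trans _ _ 0); first by rewrite pmulr_rle0.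
  by rewrite !mulr_ge0 ?sqr_ge0 ?ltW.
rewrite -ltNge => gt0 dt /andP[dt0]; rewrite ler_pdivlMr// => cfl.
exact: stab.
Qed.
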